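(* Let $A$ be a finite lattice and let $E$ be a lattice in the lattice variety $\mathcal V(A)$ generated by $A$. Then the canonical extension $E^\delta$ is doubly algebraic; the Scott topology and the upper topology on $E^\delta$ are equal and this topology is spectral; dually, the dual Scott topology and the lower topology on $E^\delta$ are equal and this topology is spectral. The bases of compact open sets of these two topologies come in complementary pairs of upper and lower teeth, and $E^\delta$ equipped with the join of the two topologies (and its order) is a Priestley space.
   Context: Lattices are bounded. A canonical extension of a lattice $L$ is a complete lattice $L^\delta$ with a lattice embedding $L\hookrightarrow L^\delta$ (identify $L$ with its image) satisfying Density (every element of $L^\delta$ is a join of meets and a meet of joins of elements of $L$) and Compactness (if $\bigwedge S\le\bigvee T$ in $L^\delta$ for $S,T\subseteq L$, then $\bigwedge S'\le\bigvee T'$ for finite $S'\subseteq S,T'\subseteq T$); it exists and is unique up to isomorphism fixing $L$. A lattice is doubly algebraic if it and its order dual are algebraic. The upper topology is generated by complements of principal downsets, the lower topology by complements of principal upsets; the dual Scott topology is the Scott topology of the order dual. An upper (lower) tooth is the upset (downset) of a finite set. *)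

(* Defs.v *)
From HB Require Import structures.
From mathcomp Require Import all_boot all_order.
From mathcomp Require Import all_classical.
From mathcomp Require Import topology.

Set Implicit Arguments.
Unset Strict Implicit.
Unset Printing Implicit Defensive.

Import Order.TTheory.

Local Open Scope order_scope.
Local Open Scope classical_set_scope.

(* Lattices are bounded, so the signature of an identity has constants for the
   two bounds. *)
Inductive lattice_term :=
  | LVar of nat
  | LBot
  | LTop
  | LMeet of lattice_term & lattice_term
  | LJoin of lattice_term & lattice_term.

Fixpoint lattice_eval d (L : tbLatticeType d) (v : nat -> L)
    (t : lattice_term) : L :=
  match t with
  | LVar n => v n
  | LBot => \bot
  | LTop => \top
  | LMeet t1 t2 => (lattice_eval v t1 `&` lattice_eval v t2)%O
  | LJoin t1 t2 => (lattice_eval v t1 `|` lattice_eval v t2)%O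
  end.

Definition models d (L : tbLatticeType d)
    (Sigma : set (lattice_term * lattice_term)) :=
  forall p, Sigma p ->
  forall v : nat -> L, lattice_eval v p.1 = lattice_eval v p.2.

(* A variety is the class of models of a set of identities; [E] belongs to the
   variety generated by [A] when it lies in every variety containing [A]. *)
Definition in_variety_generated_by dA (A : tbLatticeType dA)
    dE (E : tbLatticeType dE) :=
  forall Sigma, models A Sigma -> models E Sigma.

Section Posets.
Context {d : Order.disp_t} {T : porderType d}.

Definition upset (U : set T) := forall x y : T, x <= y -> U x -> U y.

Definition directed (D : set T) :=
  D !=set0 /\ forall x y, D x -> D y -> exists z, [/\ D z, x <= z & y <= z].

Definition joins_of (X : set T) : set T :=
  [set u | exists2 S : set T, S `<=` X & supremums S u].

Definition meets_of (X : set T) : set T :=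
  [set u | exists2 S : set T, S `<=` X & infimums S u].

Definition compact_element (k : T) :=
  forall (D : set T) (s : T), directed D -> supremums D s -> k <= s ->
  exists2 x, D x & k <= x.

Definition upper_tooth (U : set T) :=
  exists F : seq T, U = [set x | exists2 a, a \in F & a <= x].

Definition lower_tooth (U : set T) :=
  exists F : seq T, U = [set x | exists2 a, a \in F & x <= a].

Definition scott_open (U : set T) :=
  upset U /\
  forall (D : set T) (s : T), directed D -> supremums D s -> U s ->
  D `&` U !=set0.

End Posets.

Definition complete_lattice d (T : porderType d) :=
  forall S : set T, supremums S !=set0 /\ infimums S !=set0.

Definition algebraic_lattice d (T : porderType d) :=
  complete_lattice T /\
  forall x : T, joins_of [set k | compact_element k] x.

Definition doubly_algebraic d (T : porderType d) :=
  algebraic_lattice T /\ algebraic_lattice (T^d)%type.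

(* [{lmorphism L -> C}] does not ask for preservation of the bounds, and
   [{tblmorphism L -> C}] asks for nothing else; an embedding of bounded
   lattices needs both. The meet and join of [canext_compact] are finite, those
   of [canext_dense] are arbitrary. *)
Record is_canonical_extension dL (L : tbLatticeType dL) dC (C : tbLatticeType dC)
    (e : {lmorphism L -> C}) : Prop := IsCanonicalExtension {
  canext_complete : complete_lattice C;
  canext_bot : e \bot = \bot;
  canext_top : e \top = \top;
  canext_inj : injective e;
  canext_dense : forall u : C,
    joins_of (meets_of (range e)) u /\ meets_of (joins_of (range e)) u;
  canext_compact : forall (S T : set L) (s t : C),
    infimums (e @` S) s -> supremums (e @` T) t -> s <= t ->
    exists S' T' : seq L,
      [/\ [set` S'] `<=` S, [set` T'] `<=` T &
          \meet_(x <- S') e x <= \join_(x <- T') e x]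
}.

Section ScottOpens.
Context {d : Order.disp_t} {T : porderType d}.

Lemma scott_openT : scott_open [set: T].
Proof. by split=> // D s [[x Dx] _] _ _; exists x. Qed.

Lemma scott_openI : setI_closed (@scott_open d T).
Proof.
move=> U V [upU dirU] [upV dirV]; split=> [x y xy [Ux Vx]|D s dirD supD [Us Vs]].
  by split; [exact: upU xy Ux|exact: upV xy Vx].
have [x [Dx Ux]] := dirU D s dirD supD Us.
have [y [Dy Vy]] := dirV D s dirD supD Vs.
have [z [Dz xz yz]] := dirD.2 x y Dx Dy.
by exists z; split=> //; split; [exact: upU xz Ux|exact: upV yz Vy].
Qed.

Lemma scott_open_bigcup (I : Type) (f : I -> set T) :
  (forall i, scott_open (f i)) -> scott_open (\bigcup_i f i).
Proof.
move=> of_; split=> [x y xy [i _ fx]|D s dirD supD [i _ fs]].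
  by exists i => //; exact: (of_ i).1 xy fx.
have [x [Dx fx]] := (of_ i).2 D s dirD supD fs.
by exists x; split=> //; exists i.
Qed.

End ScottOpens.

(* Aliases of a poset carrying its Scott, upper and lower topologies; the dual
   Scott topology is that of [scott_space T^d]. *)
Definition scott_space d (T : porderType d) : Type := T.
Definition upper_space d (T : porderType d) : Type := T.
Definition lower_space d (T : porderType d) : Type := T.

HB.instance Definition _ d (T : porderType d) := Choice.on (scott_space T).
HB.instance Definition _ d (T : porderType d) :=
  isOpenTopological.Build (scott_space T)
    (@scott_openT d T) (@scott_openI d T) (@scott_open_bigcup d T).

HB.instance Definition _ d (T : porderType d) := Choice.on (upper_space T).
HB.instance Definition _ d (T : porderType d) :=
  isSubBaseTopological.Build (upper_space T)
    [set U : set T | exists a : T, U = ~` [set x | x <= a]] id.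

HB.instance Definition _ d (T : porderType d) := Choice.on (lower_space T).
HB.instance Definition _ d (T : porderType d) :=
  isSubBaseTopological.Build (lower_space T)
    [set U : set T | exists a : T, U = ~` [set x | a <= x]] id.

(* The poset with the join of its Scott and dual Scott topologies. *)
Definition biscott_space d (T : porderType d) : Type :=
  @sup_topology T bool (fun b =>
    if b then Topological.on (scott_space T)
    else Topological.on (scott_space (T^d)%type)).

HB.instance Definition _ d (T : porderType d) :=
  Topological.on (biscott_space T).
HB.instance Definition _ d (T : porderType d) :=
  Order.POrder.copy (biscott_space T) T.

Definition compact_opens (X : topologicalType) : set (set X) :=
  [set K | open K /\ compact K].

Definition irreducible_set (X : topologicalType) (Z : set X) :=
  Z !=set0 /\
  forall F G : set X, closed F -> closed G -> Z `<=` F `|` G ->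
  Z `<=` F \/ Z `<=` G.

Definition sober (X : topologicalType) :=
  forall Z : set X, closed Z -> irreducible_set Z ->
  exists! x : X, Z = closure [set x].

Definition spectral_space (X : topologicalType) :=
  [/\ compact [set: X],
      sober X,
      basis (@compact_opens X) &
      setI_closed (@compact_opens X)].

Definition priestley_space d (X : POrderedTopological.type d) :=
  compact [set: X] /\
  forall x y : X, ~ (x <= y) ->
  exists U : set X, [/\ clopen U, upset U, U x & ~ U y].

(* Main.v *)
From HB Require Import structures.
From Stdlib Require Import Relation_Operators.
Require Import Defs.
From mathcomp Require Import all_boot all_order.
From mathcomp Require Import all_classical.
From mathcomp Require Import topology.

(* Congruences of a lattice are encoded by the preorders Q that contain its
   order and are compatible with meets and joins. Let F be a filter and I an
   ideal of E such that f <= i for no f in F and i in I. Jonsson's lemma yields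
   such a Q with at most #|A| classes and with f Q i for no f in F and i in I.
   The quotient map of E modulo Q extends to a complete homomorphism from C onto
   E/Q, whose adjoints send the class of x to p x = /\{y | x Q y} and
   o x = \/{y | y Q x}; hence the complement of the principal upset of p x is
   the downset of the finitely many o y with not x Q y. By density and
   compactness, any u not below w is separated from w by an element whose
   principal upset has a lower tooth as complement, and dually. In a complete
   lattice with these two properties such elements are exactly the compact ones,
   the compact Scott open sets are the upper teeth whose complement is a lower
   tooth, and every ultrafilter G converges in both topologies to
   \/{/\S | S in G} = /\{\/S | S in G}. *)

Set Implicit Arguments.
Unset Strict Implicit.
Unset Printing Implicit Defensive.

Import Order.TTheory.

Local Open Scope order_scope.
Local Open Scope classical_set_scope.

(** * Lattice preorders and Jonsson's lemma *)

Section LatticePreorder.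
Context {X : Type} (meet join : X -> X -> X) (bot top : X).

(** No laws are assumed of the operations, so the record serves for term algebras as well as
    lattices: the quotient by the symmetric part of [rho] is a bounded lattice. *)
Record lattice_preorder (rho : X -> X -> Prop) : Prop := LatticePreorder {
  lp_refl : forall x, rho x x;
  lp_trans : forall y x z, rho x y -> rho y z -> rho x z;
  lp_bot : forall x, rho bot x;
  lp_top : forall x, rho x top;
  lp_meetl : forall x y, rho (meet x y) x;
  lp_meetr : forall x y, rho (meet x y) y;
  lp_meet : forall x y z, rho z x -> rho z y -> rho z (meet x y);
  lp_joinl : forall x y, rho x (join x y);
  lp_joinr : forall x y, rho y (join x y);
  lp_join : forall x y z, rho x z -> rho y z -> rho (join x y) z
}.

Lemma lp_meet_mono rho x y z : lattice_preorder rho ->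
  rho x y -> rho (meet x z) (meet y z).
Proof.
move=> lp xy; apply: (lp_meet lp); last exact: (lp_meetr lp).
exact: (lp_trans lp) (lp_meetl lp _ _) xy.
Qed.

Lemma lp_join_mono rho x y z : lattice_preorder rho ->
  rho x y -> rho (join x z) (join y z).
Proof.
move=> lp xy; apply: (lp_join lp); last exact: (lp_joinr lp).
exact: (lp_trans lp) xy (lp_joinl lp _ _).
Qed.

Definition rel_meet (rho sigma : X -> X -> Prop) x y := rho x y /\ sigma x y.

Definition rel_join (rho sigma : X -> X -> Prop) :=
  clos_trans X (fun x y => rho x y \/ sigma x y).

Lemma lp_rel_meet rho sigma : lattice_preorder rho -> lattice_preorder sigma ->
  lattice_preorder (rel_meet rho sigma).
Proof.
move=> [r1 r2 r3 r4 r5 r6 r7 r8 r9 r10] [s1 s2 s3 s4 s5 s6 s7 s8 s9 s10].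
split; rewrite /rel_meet; try by move=> *; split.
- by move=> y x z [? ?] [? ?]; split; [exact: (r2 y)|exact: (s2 y)].
- by move=> x y z [? ?] [? ?]; split; [exact: r7|exact: s7].
- by move=> x y z [? ?] [? ?]; split; [exact: r10|exact: s10].
Qed.

Lemma rel_joinl rho sigma x y : rho x y -> rel_join rho sigma x y.
Proof. by move=> ?; apply: t_step; left. Qed.

Lemma rel_joinr rho sigma x y : sigma x y -> rel_join rho sigma x y.
Proof. by move=> ?; apply: t_step; right. Qed.

Lemma lp_rel_join rho sigma : lattice_preorder rho -> lattice_preorder sigma ->
  lattice_preorder (rel_join rho sigma).
Proof.
move=> lr ls.
have tr y x z : rel_join rho sigma x y -> rel_join rho sigma y z ->
  rel_join rho sigma x z by apply: t_trans.
have jm x y z : rel_join rho sigma x y ->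
    rel_join rho sigma (join x z) (join y z).
  elim=> {x y} [x y [xy|xy]|x y w _ IH1 _]; last exact: tr.
    by apply: rel_joinl; apply: lp_join_mono.
  by apply: rel_joinr; apply: lp_join_mono.
have mm x y z : rel_join rho sigma x y ->
    rel_join rho sigma (meet x z) (meet y z).
  elim=> {x y} [x y [xy|xy]|x y w _ IH1 _]; last exact: tr.
    by apply: rel_joinl; apply: lp_meet_mono.
  by apply: rel_joinr; apply: lp_meet_mono.
case: (lr) => r1 r2 r3 r4 r5 r6 r7 r8 r9 r10.
split=> //; try by move=> *; exact: rel_joinl.
(* Since [mm] moves only the left argument, the chain from z runs through z /\ z, x /\ z, z /\ x, y
   /\ x and x /\ y. *)
- move=> x y z zx zy; apply: (tr (meet x z)).
    apply: (tr (meet z z)); last exact: mm.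
    by apply: rel_joinl; exact: r7.
  apply: (tr (meet z x)); first by apply: rel_joinl; exact: r7.
  apply: (tr (meet y x)); first exact: mm.
  by apply: rel_joinl; exact: r7.
- move=> x y z xz yz; apply: (tr (join z y)); first exact: jm.
  apply: (tr (join y z)); first by apply: rel_joinl; exact: r10.
  apply: (tr (join z z)); first exact: jm.
  by apply: rel_joinl; exact: r10.
Qed.

(* A chain from s to t is pushed into the interval between s and t by the
   polynomial a |-> (a \/ t) /\ s; any two elements there are rho-related. *)
Lemma rel_join_modular theta k rho x y :
    lattice_preorder theta -> lattice_preorder k -> lattice_preorder rho ->
    rel_join theta k x y -> rho x y ->
  rel_join theta (rel_meet k rho) x y.
Proof.
move=> lt lk lr xy rxy.
have lkr := lp_rel_join lt (lp_rel_meet lk lr).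
pose phi a := meet (join a y) x.
suff step a b : rel_join theta k a b ->
    rel_join theta (rel_meet k rho) (phi a) (phi b).
  apply: (lp_trans lkr (y := phi x)).
    by apply: (lp_meet lkr); [apply: (lp_joinl lkr)|apply: (lp_refl lkr)].
  apply: (lp_trans lkr (y := phi y)); first exact: step.
  apply: (lp_trans lkr (lp_meetl lkr _ _)).
  by apply: (lp_join lkr); apply: (lp_refl lkr).
elim=> {a b} [a b [ab|ab]|a b c _ IH1 _]; last exact: (lp_trans lkr).
  by apply: rel_joinl; apply: lp_meet_mono => //; apply: lp_join_mono.
apply: rel_joinr; split.
  by apply: lp_meet_mono => //; apply: lp_join_mono.
apply: (lp_trans lr (lp_meetr lr _ _)).
apply: (lp_meet lr); last exact: (lp_refl lr).
exact: (lp_trans lr rxy (lp_joinr lr _ _)).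
Qed.

(** Modularity is used twice: first to get a chain of steps in [theta] or in both [k1] and
    [rel_join theta k2], then to refine each step of the second sort. *)
Lemma rel_join_distr theta k1 k2 x y :
    lattice_preorder theta -> lattice_preorder k1 -> lattice_preorder k2 ->
    rel_join theta k1 x y -> rel_join theta k2 x y ->
  rel_join theta (rel_meet k1 k2) x y.
Proof.
move=> lt l1 l2 xy1 xy2.
have l12 := lp_rel_join lt (lp_rel_meet l1 l2).
elim: (rel_join_modular lt l1 (lp_rel_join lt l2) xy1 xy2) => {x y xy1 xy2}.
  move=> x y [txy|[xy1 xy2]]; first exact: rel_joinl.
  elim: (rel_join_modular lt l2 l1 xy2 xy1) => {x y xy1 xy2}.
    by move=> x y [txy|[? ?]]; [exact: rel_joinl|exact: rel_joinr].
  by move=> x y z _ ? _; apply: (lp_trans l12).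
by move=> x y z _ ? _; apply: (lp_trans l12).
Qed.

(** * Maximal preorders separating a filter from an ideal *)

Section Avoiding.
Context (F I : set X).
Hypothesis Fmeet : forall x y, F x -> F y -> F (meet x y).
Hypothesis Ijoin : forall x y, I x -> I y -> I (join x y).

Definition avoids (rho : X -> X -> Prop) :=
  forall x y, F x -> I y -> ~ rho x y.

Definition maximal_avoiding (theta : X -> X -> Prop) :=
  [/\ lattice_preorder theta, avoids theta &
      forall rho : X -> X -> Prop, lattice_preorder rho ->
        (forall x y, theta x y -> rho x y) -> avoids rho ->
        forall x y, rho x y -> theta x y].

Lemma exists_maximal_avoiding theta0 :
    lattice_preorder theta0 -> avoids theta0 ->
  exists2 theta, maximal_avoiding theta &
    forall x y, theta0 x y -> theta x y.
Proof.
move=> l0 a0.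
(* Adjoining [theta0] takes care of the empty chain, whose union then stands for [theta0] itself. *)
pose rel_of (S : set (X * X)) x y := theta0 x y \/ S (x, y).
pose P S := lattice_preorder (rel_of S) /\ avoids (rel_of S).
have [G GP Gtot|S [[lS aS] Smax]] := @Zorn_bigcup _ P; last first.
  exists (rel_of S); last by move=> x y; left.
  split=> // rho lrho Srho arho x y xy; apply: contrapT => nSxy.
  have e : rel_of [set p | rho p.1 p.2] = rho.
    rewrite funeq2E => a b; rewrite propeqE; split; last by right.
    by case=> // ?; apply: Srho; left.
  apply: (Smax [set p | rho p.1 p.2]); last by rewrite /P e.
  split; first by move=> [a b] Sab; apply: Srho; right.
  by move=> /(_ (x, y) xy) Sxy; apply: nSxy; right.
(* Each closure condition involves at most two related pairs, and these come from a single member of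
   the chain or from [theta0] alone. *)
have common x y x' y' : rel_of (\bigcup_(S in G) S) x y ->
    rel_of (\bigcup_(S in G) S) x' y' ->
    exists S, [/\ P S, S `<=` \bigcup_(S in G) S,
                  rel_of S x y & rel_of S x' y'].
  have P0 : P set0.
    rewrite /P; have -> // : rel_of set0 = theta0.
    by rewrite funeq2E => a b; rewrite propeqE; split; [case|left].
  move=> [?|[S GS Sxy]] [?|[S' GS' Sxy']].
  - by exists set0; split=> //; left.
  - exists S'; split=> //; [exact: GP|exact: bigcup_sup|by left|by right].
  - exists S; split=> //; [exact: GP|exact: bigcup_sup|by right|by left].
  - have [SS|SS] := Gtot S S' GS GS'.
      exists S'; split=> //; [exact: GP|exact: bigcup_sup| |by right].
      by right; apply: SS.
    exists S; split=> //; [exact: GP|exact: bigcup_sup|by right|].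
    by right; apply: SS.
have relS (S S' : set (X * X)) x y : S `<=` S' -> rel_of S x y -> rel_of S' x y.
  by move=> SS [?|/SS ?]; [left|right].
split; last first.
  move=> x y Fx Iy xy; have [S [[_ aS] _ Sxy _]] := common _ _ _ _ xy xy.
  exact: aS Sxy.
split; try by move=> *; left; case: l0 => *.
- move=> y x z xy yz; have [S [[lS _] SG xy' yz']] := common _ _ _ _ xy yz.
  by apply: relS SG _; apply: (lp_trans lS) xy' yz'.
- move=> x y z xy yz; have [S [[lS _] SG xy' yz']] := common _ _ _ _ xy yz.
  by apply: relS SG _; apply: (lp_meet lS) xy' yz'.
- move=> x y z xy yz; have [S [[lS _] SG xy' yz']] := common _ _ _ _ xy yz.
  by apply: relS SG _; apply: (lp_join lS) xy' yz'.
Qed.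

(** If neither [k1] nor [k2] lies in [theta], maximality makes each join with [theta] relate some xi
    in F to some yi in I. Then x1 /\ x2 and y1 \/ y2 are related by both joins, hence by [theta]
    through distributivity, which is excluded. *)
Lemma maximal_avoiding_prime theta k1 k2 : maximal_avoiding theta ->
    lattice_preorder k1 -> lattice_preorder k2 ->
    (forall x y, k1 x y -> k2 x y -> theta x y) ->
  (forall x y, k1 x y -> theta x y) \/ (forall x y, k2 x y -> theta x y).
Proof.
move=> [lt at_ tmax] l1 l2 k12.
have hits k : lattice_preorder k -> ~ (forall x y, k x y -> theta x y) ->
    exists x y, [/\ F x, I y & rel_join theta k x y].
  move=> lk nk; apply: contrapT => nhit; apply: nk => x y kxy.
  apply: (tmax (rel_join theta k)) => //; first exact: lp_rel_join.
  - by move=> a b; exact: rel_joinl.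
  - by move=> a b Fa Ib ab; apply: nhit; exists a, b.
  - exact: rel_joinr.
apply: contrapT => /not_orP[/(hits _ l1)[x1 [y1 [Fx1 Iy1 xy1]]]].
move=> /(hits _ l2)[x2 [y2 [Fx2 Iy2 xy2]]].
apply: (at_ (meet x1 x2) (join y1 y2)); [exact: Fmeet|exact: Ijoin|].
have lj1 := lp_rel_join lt l1; have lj2 := lp_rel_join lt l2.
have : rel_join theta (rel_meet k1 k2) (meet x1 x2) (join y1 y2).
  apply: rel_join_distr => //.
    apply: (lp_trans lj1 (lp_meetl lj1 _ _)).
    exact: (lp_trans lj1 xy1 (lp_joinl lj1 _ _)).
  apply: (lp_trans lj2 (lp_meetr lj2 _ _)).
  exact: (lp_trans lj2 xy2 (lp_joinr lj2 _ _)).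
elim=> [x y [//|[? ?]]|x y z _ ? _]; first exact: k12.
exact: (lp_trans lt).
Qed.

End Avoiding.
End LatticePreorder.

Definition order_lattice_preorder d (L : tbLatticeType d) :=
  lattice_preorder (@Order.meet _ L) (@Order.join _ L) \bot \top.

Definition equivr (X : Type) (Q : X -> X -> Prop) x y := Q x y /\ Q y x.

Lemma finite_representatives (X : Type) (Q : X -> X -> Prop) n :
    (forall s : seq X, pairwise (fun x y => ~~ `[< equivr Q x y >]) s ->
       (size s <= n)%N) ->
  exists r : seq X, forall x, has (fun y => `[< equivr Q x y >]) r.
Proof.
move=> bound.
(* While [s] does not represent all classes, a new element is adjoined; [m] counts the adjunctions
   left before the length exceeds [n]. *)
suff ext m (s : seq X) : pairwise (fun x y => ~~ `[< equivr Q x y >]) s ->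
    (n < size s + m)%N ->
    exists r : seq X, forall x, has (fun y => `[< equivr Q x y >]) r.
  by apply: (ext n.+1 [::]).
elim: m s => [|m IHm] s ps; first by rewrite addn0 ltnNge bound.
move=> ns; apply: contrapT => nr; apply: (nr).
have /forallNP/(_ s)/existsNP[x /negP nx] := nr.
apply: (IHm (x :: s)); last by rewrite /= addSnnS.
by rewrite /= ps andbT all_predC.
Qed.

(** * Terms and the variety generated by a finite lattice *)

Inductive term (X : Type) :=
  | TVar of X
  | TBot
  | TTop
  | TMeet of term X & term X
  | TJoin of term X & term X.

Arguments TBot {X}.
Arguments TTop {X}.

Fixpoint term_eval (X : Type) d (L : tbLatticeType d) (v : X -> L) t : L :=
  match t with
  | TVar x => v x
  | TBot => \bot
  | TTop => \top
  | TMeet t1 t2 => (term_eval v t1 `&` term_eval v t2)%O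
  | TJoin t1 t2 => (term_eval v t1 `|` term_eval v t2)%O
  end.

Fixpoint term_vars (X : Type) (t : term X) : seq X :=
  match t with
  | TVar x => [:: x]
  | TBot | TTop => [::]
  | TMeet t1 t2 | TJoin t1 t2 => term_vars t1 ++ term_vars t2
  end.

(** Identities have numbered variables, whereas Jonsson's argument takes the elements of [E] as
    variables, evaluated by [id]. *)
Fixpoint lattice_term_of (X : Type) (f : X -> nat) (t : term X) :=
  match t with
  | TVar x => LVar (f x)
  | TBot => LBot
  | TTop => LTop
  | TMeet t1 t2 => LMeet (lattice_term_of f t1) (lattice_term_of f t2)
  | TJoin t1 t2 => LJoin (lattice_term_of f t1) (lattice_term_of f t2)
  end.

Lemma lattice_eval_term_of (X : Type) d (L : tbLatticeType d) (f : X -> nat)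
    (v : nat -> L) t :
  lattice_eval v (lattice_term_of f t) = term_eval (v \o f) t.
Proof. by elim: t => //= t1 -> t2 ->. Qed.

Lemma eq_term_eval (X : eqType) d (L : tbLatticeType d) (v w : X -> L) t :
  {in term_vars t, v =1 w} -> term_eval v t = term_eval w t.
Proof.
elim: t => //= [x|t1 IH1 t2 IH2|t1 IH1 t2 IH2] vw.
- by apply: vw; rewrite inE.
- by rewrite IH1 ?IH2 // => x xt; apply: vw; rewrite mem_cat xt ?orbT.
- by rewrite IH1 ?IH2 // => x xt; apply: vw; rewrite mem_cat xt ?orbT.
Qed.

(** The order of the power of [L] indexed by [J], pulled back along evaluation; it shrinks as [J]
    grows. *)
Definition eval_rel (X : Type) d (L : tbLatticeType d) (J : set (X -> L))
    t1 t2 :=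
  forall v, J v -> term_eval v t1 <= term_eval v t2.

Definition term_preorder (X : Type) :=
  lattice_preorder (@TMeet X) (@TJoin X) TBot TTop.

Lemma eval_rel_preorder (X : Type) d (L : tbLatticeType d) (J : set (X -> L)) :
  term_preorder (eval_rel J).
Proof.
split=> /=.
- by move=> x v _.
- by move=> y x z xy yz v Jv; exact: le_trans (xy v Jv) (yz v Jv).
- by move=> x v _; exact: le0x.
- by move=> x v _; exact: lex1.
- by move=> x y v _; exact: leIl.
- by move=> x y v _; exact: leIr.
- by move=> x y z zx zy v Jv /=; rewrite lexI zx ?zy.
- by move=> x y v _; exact: leUl.
- by move=> x y v _; exact: leUr.
- by move=> x y z zx zy v Jv /=; rewrite leUx zx ?zy.
Qed.

Section Variety.
Context (dA dE : Order.disp_t) (A : finTBLatticeType dA) (E : tbLatticeType dE).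
Hypothesis hE : in_variety_generated_by A E.

(** Only finitely many variables occur. Numbered by their positions in [l], they turn the equation
    into an identity of [A], which [E] inherits. *)
Lemma variety_term_eq (t1 t2 : term E) :
    (forall v : E -> A, term_eval v t1 = term_eval v t2) ->
  term_eval id t1 = term_eval id t2.
Proof.
move=> eqA; pose l := term_vars t1 ++ term_vars t2.
pose f x := index x l.
have := hE (Sigma := [set (lattice_term_of f t1, lattice_term_of f t2)]).
move=> /(_ _ _ erefl (nth \bot l)); rewrite /= !lattice_eval_term_of.
have idE t : {subset term_vars t <= l} ->
    term_eval (nth \bot l \o f) t = term_eval id t.
  by move=> tl; apply: eq_term_eval => x /tl xl /=; rewrite nth_index.
rewrite !idE; first 1 last.
- by move=> x xt; rewrite mem_cat xt orbT.
- by move=> x xt; rewrite mem_cat xt.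
by apply=> _ -> v; rewrite /= !lattice_eval_term_of.
Qed.

Lemma variety_eval_rel (t1 t2 : term E) :
  eval_rel [set: E -> A] t1 t2 -> term_eval id t1 <= term_eval id t2.
Proof.
move=> le12; rewrite leEmeet; apply/eqP.
by apply: (variety_term_eq (t1 := TMeet t1 t2)) => v; exact/meet_idPl/le12.
Qed.

(* Jonsson's lemma: maximality makes [fun J => eval_rel J] a prime condition on
   sets J of valuations in A, and by the pigeonhole principle the sets on which
   two given terms out of #|A| + 1 take the same value cover all valuations. *)
Lemma variety_separation (F I : set E) :
    (forall x y, F x -> F y -> F (x `&` y)%O) ->
    (forall x y, I x -> I y -> I (x `|` y)%O) ->
    F !=set0 -> I !=set0 ->
    (forall x y, F x -> I y -> ~ x <= y) ->
  exists Q : E -> E -> Prop,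
    [/\ order_lattice_preorder Q, (forall x y, x <= y -> Q x y),
        (exists r : seq E, forall x, has (fun y => `[< equivr Q x y >]) r) &
        forall x y, F x -> I y -> ~ Q x y].
Proof.
move=> Fmeet Ijoin [x0 Fx0] [y0 Iy0] FI.
pose ev := @term_eval E _ E id.
have l0 : term_preorder (fun t1 t2 => ev t1 <= ev t2).
  have := eval_rel_preorder [set id : E -> E].
  congr (term_preorder _); rewrite funeq2E => t1 t2; rewrite propeqE.
  by split=> [/(_ id erefl)//|le12 _ ->].
have [theta thmax th0] :=
  exists_maximal_avoiding (F := ev @^-1` F) (I := ev @^-1` I) l0
    (fun x y Fx Iy => FI _ _ Fx Iy).
(* Despite the name, supersets of a [small] set are [small]; these sets act like the members of an
   ultrafilter. *)
pose small J := forall t1 t2, eval_rel (L := A) J t1 t2 -> theta t1 t2.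
have prime J J1 J2 : J `<=` J1 `|` J2 -> small J -> small J1 \/ small J2.
  move=> JJ sJ; apply: (maximal_avoiding_prime _ _ thmax).
  - by move=> x y; exact: Fmeet.
  - by move=> x y; exact: Ijoin.
  - exact: eval_rel_preorder.
  - exact: eval_rel_preorder.
  - by move=> t1 t2 k1 k2; apply: sJ => v /JJ[/k1|/k2].
have [lth ath _] := thmax.
(* [eval_rel set0] relates all terms, in particular the variables [x0] and [y0]. *)
have nsmall0 : ~ small set0.
  by move=> sm; apply: (ath (TVar x0) (TVar y0)) => //; apply: sm => v.
pose Q x y := theta (TVar x) (TVar y).
have nsmall_mem x s : all (fun y => ~~ `[< equivr Q x y >]) s ->
    ~ small [set v | v x \in [seq v y | y <- s]].
  elim: s => [_|y s IHs /= /andP[/asboolP nxy /IHs nsm] sm].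
    by apply: contra_not nsmall0 => sm t1 t2 t12; apply: sm => v.
  have [|{}sm|/nsm//] := prime _ [set v | v x = v y]
      [set v | v x \in [seq v z | z <- s]] _ sm.
    by move=> v /=; rewrite inE => /orP[/eqP|]; [left|right].
  by apply: nxy; split; apply: sm => v /= ->.
have nsmall_uniq s : pairwise (fun x y => ~~ `[< equivr Q x y >]) s ->
    ~ small [set v | ~~ uniq [seq v y | y <- s]].
  elim: s => [_|x s IHs /= /andP[/nsmall_mem nm /IHs nsm] sm].
    by apply: contra_not nsmall0 => sm t1 t2 t12; apply: sm => v.
  have [|/nm//|/nsm//] := prime _ [set v | v x \in [seq v z | z <- s]]
      [set v | ~~ uniq [seq v z | z <- s]] _ sm.
  by move=> v /=; rewrite negb_and negbK => /orP[]; [left|right].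
exists Q; split.
(* A compound term may be exchanged for the variable naming its value in [E], so the laws of [theta]
   descend to [Q]. *)
- have thE t1 t2 : ev t1 = ev t2 -> theta t1 t2 by move=> e; apply: th0;
    rewrite e.
  case: (lth) => h1 h2 h3 h4 h5 h6 h7 h8 h9 h10; split=> /=.
  + by move=> x; exact: h1.
  + by move=> y x z; exact: h2.
  + by move=> x; apply: th0; exact: le0x.
  + by move=> x; apply: th0; exact: lex1.
  + by move=> x y; apply: th0; rewrite /= leIl.
  + by move=> x y; apply: th0; rewrite /= leIr.
  + move=> x y z zx zy; apply: (h2 (TMeet (TVar x) (TVar y))); first exact: h7.
    exact: thE.
  + by move=> x y; apply: th0; rewrite /= leUl.
  + by move=> x y; apply: th0; rewrite /= leUr.
  + move=> x y z zx zy; apply: (h2 (TJoin (TVar x) (TVar y))); first exact: thE.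
    exact: h10.
- by move=> x y xy; apply: th0.
(* For [s] longer than #|A| no valuation is injective on [s], and the set of all valuations is
   [small] because [E] satisfies the identities of [A]. *)
- apply: (@finite_representatives _ Q #|A|) => s /nsmall_uniq ns.
  rewrite leqNgt; apply/negP => As; apply: ns => t1 t2 t12; apply: th0.
  apply: variety_eval_rel => v _; apply: t12 => /=.
  apply: contraL As => /card_uniqP; rewrite size_map -leqNgt => <-.
  exact: max_card.
- by move=> x y Fx Iy; apply: ath.
Qed.
End Variety.

(** * Lattices with enough splitting elements *)

(** Applied to teeth, which are finite unions of principal upsets or downsets. *)
Lemma ultra_exists_seq (X : Type) (I : eqType) (G : set_system X) (s : seq I)
    (f : I -> set X) :
    UltraFilter G -> G [set x | exists2 a, a \in s & f a x] ->
  exists2 a, a \in s & G (f a).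
Proof.
move=> UG; elim: s => [|a s IHs] Gs.
  have G0 : G set0 by apply: filterS Gs => x [].
  by have [x] := filter_ex G0.
have [Ga|Gna] := in_ultra_setVsetC (f a) UG.
  by exists a; rewrite ?mem_head.
have [|b bs Gb] := IHs; last by exists b => //; rewrite in_cons bs orbT.
apply: filterS (filterI Gs Gna) => x [[b]]; rewrite in_cons => /predU1P[->|bs].
  by move=> ? [].
by move=> ? _; exists b.
Qed.

(** * Teeth and Scott open sets *)

Section Teeth.
Context {d : Order.disp_t} {T : porderType d}.

Lemma upper_tooth0 : upper_tooth (@set0 T).
Proof. by exists [::]; apply/esym; rewrite -subset0 => x []. Qed.

Lemma upper_tooth_ge (p : T) : upper_tooth [set x | p <= x].
Proof.
exists [:: p]; apply/seteqP; split=> x /=; first by exists p; rewrite ?inE.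
by move=> [a]; rewrite inE => /eqP ->.
Qed.

Lemma upper_toothU (U V : set T) :
  upper_tooth U -> upper_tooth V -> upper_tooth (U `|` V).
Proof.
move=> [F ->] [G ->]; exists (F ++ G); apply/seteqP; split=> x /=.
  by move=> [] [a aF ax]; exists a; rewrite // mem_cat aF ?orbT.
by move=> [a]; rewrite mem_cat => /orP[aF|aG] ax; [left|right]; exists a.
Qed.

(** If some y in D is not below the head a of F, every x in D has an upper bound in D that is above
    y, hence not below a; so the tail of F already covers D. *)
Lemma directed_in_tooth (D : set T) (F : seq T) : directed D ->
    (forall x, D x -> exists2 a, a \in F & x <= a) ->
  exists2 a, a \in F & forall x, D x -> x <= a.
Proof.
move=> [[x0 Dx0] dirD]; elim: F => [|a F IHF] DF.
  by have [a] := DF _ Dx0; rewrite in_nil.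
have [Da|/existsNP[y /not_implyP[Dy nya]]] :=
  pselect (forall x, D x -> x <= a); first by exists a; rewrite ?mem_head.
have [|b bF Db] := IHF; last by exists b; rewrite // in_cons bF orbT.
move=> x Dx; have [z [Dz xz yz]] := dirD x y Dx Dy.
have [b] := DF z Dz; rewrite in_cons => /predU1P[->|bF] zb.
  by case: nya; exact: le_trans yz zb.
by exists b => //; exact: le_trans xz zb.
Qed.

(** A directed set outside U lies below a single generator of the tooth, and so does its
    supremum. *)
Lemma scott_open_lower_toothC (U : set T) : lower_tooth (~` U) -> scott_open U.
Proof.
move=> [F UF].
have nU x : ~ U x <-> exists2 a, a \in F & x <= a.
  by have := congr1 (fun V : set T => V x) UF => /= ->.
split=> [x y xy Ux|D s dirD supD Us].
  apply: contrapT => /nU[a aF ya]; apply: (nU x).2 Ux.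
  by exists a => //; exact: le_trans xy ya.
apply: contrapT => DU.
have [x Dx|a aF Da] := directed_in_tooth dirD (F := F).
  by apply/nU => Ux; apply: DU; exists x.
by apply: (nU s).2 Us; exists a => //; exact: supD.2.
Qed.

(** With exactly one generator a, the pair (p, a) splits the poset into a principal upset and a
    principal downset; here any finite number of generators is allowed. *)
Definition splits (p : T) := lower_tooth (~` [set x | p <= x]).

Lemma scott_open_ge (p : T) : splits p -> scott_open [set x | p <= x].
Proof. exact: scott_open_lower_toothC. Qed.

End Teeth.

Section ScottTeeth.
Context {d : Order.disp_t} {T : porderType d}.

Lemma scott_open_nle (a : T) : scott_open (~` [set x | x <= a]).
Proof.
apply: scott_open_lower_toothC; rewrite setCK.
exact: (@upper_tooth_ge _ (T^d)%type a).
Qed.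

Lemma splits_compact (p : T) : splits p -> compact_element p.
Proof.
move=> /scott_open_ge[_ op] D s dirD supD /(op _ _ dirD supD)[x []].
by exists x.
Qed.

End ScottTeeth.

Section LatticeTeeth.
Context {d : Order.disp_t} {T : tbLatticeType d}.

Lemma upper_toothT : upper_tooth [set: T].
Proof.
have -> : [set: T] = [set x | \bot <= x] by apply/seteqP; split=> x //= _.
exact: upper_tooth_ge.
Qed.

Lemma upper_toothI (U V : set T) :
  upper_tooth U -> upper_tooth V -> upper_tooth (U `&` V).
Proof.
move=> [F ->] [G ->]; exists [seq (a `|` b)%O | a <- F, b <- G].
apply/seteqP; split=> x /=.
  move=> [[a aF ax] [b bG bx]]; exists (a `|` b)%O; last by rewrite leUx ax.
  exact: allpairs_f.
move=> [_ /allpairsP[[a b] [/= aF bG ->]]]; rewrite leUx => /andP[ax bx].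
by split; [exists a|exists b].
Qed.

End LatticeTeeth.

(** * The Scott topology when splitting elements are dense *)

Section LatticeSplits.
Context {d : Order.disp_t} {T : tbLatticeType d}.

Lemma lower_toothI (U V : set T) :
  lower_tooth U -> lower_tooth V -> lower_tooth (U `&` V).
Proof. exact: (@upper_toothI _ (T^d)%type). Qed.

Lemma splits0 : splits (\bot : T).
Proof.
rewrite /splits (_ : [set x | _] = setT) ?setCT.
  exact: (@upper_tooth0 _ (T^d)%type).
by apply/seteqP; split=> x //= _.
Qed.

Lemma splitsU (p q : T) : splits p -> splits q -> splits (p `|` q)%O.
Proof.
move=> sp sq; rewrite /splits.
rewrite (_ : [set x | _] = [set x | p <= x] `&` [set x | q <= x]).
  by rewrite setCI; exact: (@upper_toothU _ (T^d)%type).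
by apply/seteqP; split=> x /=; rewrite leUx => /andP.
Qed.

(** Contrapositive form of: every u is the supremum of the splitting elements below it. *)
Definition splits_dense := forall u w : T, ~ u <= w ->
  exists p, [/\ splits p, p <= u & ~ p <= w].

Hypothesis dense : splits_dense.

Lemma splits_below_directed (x : T) : directed [set p | splits p /\ p <= x].
Proof.
split; first by exists \bot; split; [exact: splits0|exact: le0x].
move=> p q [sp px] [sq qx]; exists (p `|` q)%O; split; last exact: leUr.
  by split; [exact: splitsU|rewrite leUx px].
exact: leUl.
Qed.

Lemma splits_below_sup (x : T) : supremums [set p | splits p /\ p <= x] x.
Proof.
split=> [p []//|y xy]; apply: contrapT => /dense[p [sp px]].
by apply; exact: xy.
Qed.

Lemma scott_open_splits (U : set T) x : scott_open U -> U x ->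
  exists p, [/\ splits p, p <= x & U p].
Proof.
move=> [_ oU] Ux.
have [p [[sp px] Up]] :=
  oU _ x (splits_below_directed x) (splits_below_sup x) Ux.
by exists p.
Qed.

(** A compact open set is a finite union of principal upsets of splitting elements. Conversely, an
    ultrafilter containing an upper tooth contains the upset of some generator, and converges to
    it. *)
Lemma compact_openE (U : set T) :
  @compact_opens (scott_space T) U <-> upper_tooth U /\ lower_tooth (~` U).
Proof.
split=> [[oU cU]|[[F UF] tU]]; last first.
  split; first exact: scott_open_lower_toothC.
  rewrite compact_ultra => G UG; rewrite UF => /ultra_exists_seq[a aF Ga].
  exists a; split; first by exists a.
  move=> N [B [[upB _] Ba BN]]; apply: filterS Ga => x ax.
  by apply: BN; exact: upB ax Ba.
(* The base point [\bot] serves only to apply [compact_cover]. *)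
pose X : ptopologicalType :=
  HB.pack (scott_space T) (isPointed.Build (scott_space T) (\bot : T)).
have : @compact X U by [].
rewrite compact_cover => /(_ T [set p | splits p /\ U p]).
move=> /(_ (fun p => [set x | p <= x])) [p [sp _]|x /(scott_open_splits oU)|].
- exact: scott_open_ge.
- by move=> [p [sp px Up]]; exists p.
move=> D Dsub UD.
have -> : U = [set x | exists2 a, a \in finmap.enum_fset D & a <= x].
  apply/seteqP; split=> x; first by move=> /UD[a aD ax]; exists a.
  by move=> [a /Dsub/set_mem[_ Ua] ax]; exact: oU.1 ax Ua.
split; first by exists (finmap.enum_fset D).
have : forall a, a \in finmap.enum_fset D -> splits a.
  by move=> a /Dsub/set_mem[].
elim: (finmap.enum_fset D) => [_|a s IHs Ds].
  rewrite (_ : [set x | _] = set0) ?setC0; last by rewrite -subset0 => x [].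
  exact: (@upper_toothT _ (T^d)%type).
rewrite (_ : [set x | _] =
    [set x | a <= x] `|` [set x | exists2 a, a \in s & a <= x]); last first.
  apply/seteqP; split=> x /=.
    by move=> [b]; rewrite in_cons => /predU1P[->|bs] bx; [left|right; exists b].
  move=> [ax|[b bs bx]]; first by exists a; rewrite ?mem_head.
  by exists b; rewrite // in_cons bs orbT.
rewrite setCU; apply: lower_toothI; first by apply: Ds; rewrite mem_head.
by apply: IHs => b bs; apply: Ds; rewrite in_cons bs orbT.
Qed.

(** Scott open sets are unions of upsets of splitting elements, and each such upset is a finite
    intersection of complements of principal downsets. *)
Lemma scott_open_upper :
  @open (scott_space T) = @open (upper_space T) :> set (set T).
Proof.
have nle a : @open (upper_space T) (~` [set x | x <= a]).
  exists [set ~` [set x | x <= a]]; last by rewrite bigcup_set1.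
  by move=> _ ->; apply: finI_from1; exists a.
apply/seteqP; split=> U oU.
  have -> : U = \bigcup_(p in [set p | splits p /\ U p]) [set x | p <= x].
    apply/seteqP; split=> x; last by move=> [p [_ Up] px]; exact: oU.1 px Up.
    by move=> /(scott_open_splits oU)[p [? ? ?]]; exists p.
  apply: (@bigcup_open (upper_space T)) => p [[F pF] _].
  rewrite -[X in open X]setCK pF => {pF}.
  elim: F => [|a s IHs].
    rewrite (_ : [set x | _] = set0) ?setC0; last by rewrite -subset0 => x [].
    exact: (@openT (upper_space T)).
  rewrite (_ : [set x | _] =
      [set x | x <= a] `|` [set x | exists2 a, a \in s & x <= a]); last first.
    apply/seteqP; split=> x /=.
      by move=> [b]; rewrite in_cons => /predU1P[->|bs] bx; [left|right; exists b].
    move=> [ax|[b bs bx]]; first by exists a; rewrite ?mem_head.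
    by exists b; rewrite // in_cons bs orbT.
  by rewrite setCU; apply: (@openI (upper_space T)).
have [B Bfin <-] := oU.
apply: (@bigcup_open (scott_space T)) => V /Bfin[D Dsub <-].
rewrite openE => x Dx; apply: filter_bigI => W WD.
have /set_mem[a Wa] := Dsub W WD.
apply: open_nbhs_nbhs; split; last exact: Dx W WD.
rewrite /= Wa; exact: scott_open_nle.
Qed.

Lemma scott_closure1 (x : T) :
  closure [set x : scott_space T] = [set y | y <= x].
Proof.
apply/seteqP; split=> y /=.
  move=> cly; apply: contrapT => nyx.
  have [|_ [-> /=]] := cly (~` [set z | z <= x]); last exact.
  by apply: open_nbhs_nbhs; split=> //; exact: scott_open_nle.
move=> yx N [B [oB By BN]]; exists x; split=> //.
by apply: BN; exact: oB.1 yx By.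
Qed.

Hypothesis complete : complete_lattice T.

(** The generic point is the supremum of the splitting elements in Z. They are directed: if p \/ q
    were outside Z, the closed complements of the upsets of p and q would cover Z, against
    irreducibility. *)
Lemma scott_sober : sober (scott_space T).
Proof.
move=> Z cZ [[z0 Zz0] irrZ].
have [upZ dirZ] : scott_open (~` Z) := closed_openC cZ.
have lowZ (x y : T) : x <= y -> Z y -> Z x.
  by move=> xy Zy; apply: contrapT => /(upZ _ _ xy).
have dirD : directed [set p : T | splits p /\ Z p].
  split; first by exists \bot; split; [exact: splits0|exact: lowZ (le0x _) Zz0].
  move=> p q [sp Zp] [sq Zq]; exists (p `|` q)%O; split; last exact: leUr.
    split; first exact: splitsU.
    apply: contrapT => nZpq.
    have closed_nge (r : T) : splits r ->
        closed (~` [set x | r <= x] : set (scott_space T)).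
      by move=> sr; apply: open_closedC; exact: scott_open_ge.
    have [|/(_ p Zp)|/(_ q Zq)] :=
        irrZ _ _ (closed_nge p sp) (closed_nge q sq).
    - move=> x Zx; apply: contrapT => /not_orP[/contrapT px /contrapT qx].
      by apply: nZpq; apply: lowZ Zx; rewrite leUx px.
    - by move=> /(_ (lexx p)).
    - by move=> /(_ (lexx q)).
  exact: leUl.
have [s supD] := (complete [set p | splits p /\ Z p]).1.
have Zs : Z s.
  apply: contrapT => nZs.
  by have [p [[_ Zp]]] := dirZ _ _ dirD supD nZs; apply.
have Zle x : Z x -> x <= s.
  move=> Zx; apply: contrapT => /dense[p [sp px]]; apply.
  by apply: supD.1; split=> //; exact: lowZ px Zx.
exists s; split=> [|t].
  rewrite scott_closure1; apply/seteqP; split=> x; first exact: Zle.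
  by move/lowZ; exact.
move=> Zt; apply: le_anti; rewrite Zle; last first.
  by rewrite Zt; exact: subset_closure.
by move: Zs; rewrite Zt scott_closure1 => ->.
Qed.

Lemma scott_spectral : spectral_space (scott_space T).
Proof.
split; last 1 first.
- move=> U V /compact_openE[upU lowU] /compact_openE[upV lowV].
  apply/compact_openE; split; first exact: upper_toothI.
  by rewrite setCI; exact: (@upper_toothU _ (T^d)%type).
- have [|_] := (compact_openE [set: T]).2; last exact.
  split; first exact: upper_toothT.
  by rewrite setCT; exact: (@upper_tooth0 _ (T^d)%type).
- exact: scott_sober.
- split=> [U []//|x N [B [oB Bx BN]]].
  have [p [sp px Bp]] := scott_open_splits oB Bx.
  exists [set y | p <= y]; last by move=> y py; apply: BN; exact: oB.1 py Bp.
  split=> //; apply/compact_openE; split; [exact: upper_tooth_ge|exact: sp].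
Qed.

Lemma splits_algebraic : algebraic_lattice T.
Proof.
split=> // x; exists [set p | splits p /\ p <= x]; last exact: splits_below_sup.
by move=> p [sp _]; exact: splits_compact.
Qed.

(** The infima of members of G are directed because G is closed under intersection, so an open set
    around u contains one of them, and with it a member of G. *)
Lemma ultra_cvg_scott (G : set_system T) (u : T) : UltraFilter G ->
    supremums [set m | exists2 S, G S & infimums S m] u ->
  G --> (u : scott_space T).
Proof.
move=> UG supu N [B [[upB dirB] Bu BN]].
have [|m [[S GS infm] Bm]] := dirB _ _ _ supu Bu.
  split.
    have [m infm] := (complete setT).2.
    by exists m, setT => //; exact: filterT.
  move=> x y [S GS infx] [S' GS' infy].
  have [z infz] := (complete (S `&` S')).2.
  exists z; split; first by exists (S `&` S') => //; exact: filterI.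
    by apply: infz.2 => w [Sw _]; exact: infx.1.
  by apply: infz.2 => w [_ Sw]; exact: infy.1.
by apply: filterS GS => x Sx; apply: BN; apply: upB Bm; exact: infm.1.
Qed.

(** Members of G meet, so u <= w. For a splitting p <= w, either the upset of p is in G and p <= u,
    or G contains the downset of some generator a of its complement, and then w <= a contradicts p
    <= w. *)
Lemma ultra_liminf_limsup (G : set_system T) (u w : T) : UltraFilter G ->
    supremums [set m | exists2 S, G S & infimums S m] u ->
    infimums [set m | exists2 S, G S & supremums S m] w ->
  w = u.
Proof.
move=> UG supu infw; apply: le_anti; apply/andP; split; last first.
  apply: supu.2 => m [S GS infm]; apply: infw.2 => m' [S' GS' supm'].
  have [x [Sx S'x]] := filter_ex (filterI GS GS').
  exact: le_trans (infm.1 _ Sx) (supm'.1 _ S'x).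
apply: contrapT => /dense[p [[F pF] pw]]; apply.
have [Gp|] := in_ultra_setVsetC [set x | p <= x] UG.
  apply: supu.1; exists [set x | p <= x] => //.
  by split=> [x //|x]; apply; exact: lexx.
rewrite pF => /ultra_exists_seq[a aF Ga].
have : (~` [set x | p <= x]) w.
  rewrite pF; exists a => //; apply: infw.1; exists [set x | x <= a] => //.
  by split=> [x //|x]; apply; exact: lexx.
by move/(_ pw).
Qed.

End LatticeSplits.

(** * The join of the Scott and dual Scott topologies *)

Section Bisplit.
Context {d : Order.disp_t} {T : tbLatticeType d}.
Hypothesis complete : complete_lattice T.
Hypothesis dense : @splits_dense _ T.
Hypothesis dense_dual : @splits_dense _ (T^d)%type.

Lemma complete_dual : complete_lattice (T^d)%type.
Proof. by move=> S; have [] := complete S. Qed.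

Lemma biscott_open (b : bool) (U : set T) :
    (if b then scott_open U else @scott_open _ (T^d)%type U) ->
  @open (biscott_space T) U.
Proof.
move=> oU; exists [set U]; last by rewrite bigcup_set1.
by move=> _ ->; apply: finI_from1; exists b => //; case: b oU.
Qed.

(** An ultrafilter converges in both topologies to its common lower and upper limit. The upset of a
    splitting p is clopen: it is Scott open, and dual Scott closed as an upper tooth. *)
Lemma biscott_priestley : priestley_space (biscott_space T).
Proof.
split.
  rewrite compact_ultra => G UG _.
  have [u supu] := (complete [set m | exists2 S, G S & infimums S m]).1.
  have [w infw] := (complete [set m | exists2 S, G S & supremums S m]).2.
  have wu := ultra_liminf_limsup dense UG supu infw.
  exists u; split=> //; apply/cvg_sup => -[].
    exact: (ultra_cvg_scott complete UG supu).
  by rewrite -wu; exact: (@ultra_cvg_scott _ (T^d)%type complete_dual).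
move=> x y /dense[p [sp px npy]]; exists [set z | p <= z]; split=> //.
  split; first exact: (@biscott_open true) (scott_open_ge sp).
  rewrite -openC; apply: (@biscott_open false).
  apply: (@scott_open_lower_toothC _ (T^d)%type); rewrite setCK.
  exact: (@upper_tooth_ge _ T p).
by move=> a b ab /= pa; exact: le_trans pa ab.
Qed.

Lemma compact_open_setC (U : set T) :
  @compact_opens (scott_space T) U <->
  @compact_opens (scott_space (T^d)%type) (~` U).
Proof.
split=> [/(compact_openE dense)[upU lowU]|].
  by apply/(compact_openE dense_dual); rewrite setCK.
move=> /(compact_openE dense_dual); rewrite setCK => -[lowU upU].
exact/(compact_openE dense).
Qed.

End Bisplit.

(** * Canonical extensions *)

(** One element of S is chosen from each of the finitely many classes that S meets, and [op]
    combines them. *)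
Lemma least_modulo (X : eqType) (Q : X -> X -> Prop) (op : X -> X -> X)
    (r : seq X) (S : set X) :
    (forall y x z, Q x y -> Q y z -> Q x z) ->
    (forall x y, Q (op x y) x) -> (forall x y, Q (op x y) y) ->
    (forall x, exists2 y, y \in r & equivr Q x y) ->
    S !=set0 -> (forall x y, S x -> S y -> S (op x y)) ->
  exists2 c, S c & forall a, S a -> Q c a.
Proof.
move=> tr opl opr rE [s0 Ss0] Sop.
suff : exists2 c, S c &
    forall a, S a -> (exists2 y, y \in r & equivr Q a y) -> Q c a.
  by move=> [c Sc Qc]; exists c => // a Sa; exact: Qc.
elim: {rE} r => [|y r [c Sc Qc]]; first by exists s0 => // a _ [].
have [[a [Sa Qay Qya]]|nS] := pselect (exists a, [/\ S a, Q a y & Q y a]).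
  exists (op c a); first exact: Sop.
  move=> b Sb [z]; rewrite in_cons => /predU1P[->|zr] [bz zb].
    by apply: (tr a); [exact: opr|exact: tr Qay zb].
  by apply: (tr c); [exact: opl|apply: Qc => //; exists z].
exists c => // a Sa [z]; rewrite in_cons => /predU1P[->|zr] [az za].
  by case: nS; exists a.
by apply: Qc => //; exists z.
Qed.

Section CanonicalExtension.
Context (dE dC : Order.disp_t) (E : tbLatticeType dE) (C : tbLatticeType dC).
Context (e : {lmorphism E -> C}).
Hypothesis hC : is_canonical_extension e.

Lemma canext_le x y : (e x <= e y) = (x <= y).
Proof.
by rewrite !leEmeet -omorphI; apply/eqP/eqP => [/(canext_inj hC)|->].
Qed.

Lemma canext_meets (s : seq E) : \meet_(x <- s) e x = e (\meet_(x <- s) x).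
Proof.
elim: s => [|x s IHs]; first by rewrite !big_nil (canext_top hC).
by rewrite !big_cons IHs omorphI.
Qed.

Lemma canext_joins (s : seq E) : \join_(x <- s) e x = e (\join_(x <- s) x).
Proof.
elim: s => [|x s IHs]; first by rewrite !big_nil (canext_bot hC).
by rewrite !big_cons IHs omorphU.
Qed.

(** Filters and ideals absorb the finite meet and join that compactness provides, leaving single
    elements. *)
Lemma canext_filter_ideal (F I : set E) (s t : C) :
    infimums (e @` F) s -> supremums (e @` I) t -> s <= t ->
    F \top -> (forall x y, F x -> F y -> F (x `&` y)%O) ->
    I \bot -> (forall x y, I x -> I y -> I (x `|` y)%O) ->
  exists a b, [/\ F a, I b & a <= b].
Proof.
move=> infs supt st F1 FI I0 II.
have [S [T [SF TI]]] := canext_compact hC infs supt st.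
rewrite canext_meets canext_joins canext_le => ST.
exists (\meet_(x <- S) x), (\join_(x <- T) x); split=> //.
  by rewrite big_seq; elim/big_ind: _ => // x /SF.
by rewrite big_seq; elim/big_ind: _ => // x /TI.
Qed.

Lemma closed_infimum q : meets_of (range e) q ->
  infimums (e @` [set a | q <= e a]) q.
Proof.
move=> [S Srange infq]; split=> [_ [a qa <-] //|x xq].
apply: infq.2 => y Sy; have [a _ ay] := Srange y Sy.
by apply: xq; exists a => //=; rewrite ay; exact: infq.1.
Qed.

Lemma open_supremum g : joins_of (range e) g ->
  supremums (e @` [set b | e b <= g]) g.
Proof.
move=> [S Srange supg]; split=> [_ [a ag <-] //|x gx].
apply: supg.2 => y Sy; have [a _ ay] := Srange y Sy.
by apply: gx; exists a => //=; rewrite ay; exact: supg.1.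
Qed.

Lemma filter_ge q : [/\ q <= e \top &
  forall x y, q <= e x -> q <= e y -> q <= e (x `&` y)%O].
Proof.
by rewrite (canext_top hC) lex1; split=> // x y qx qy; rewrite omorphI lexI qx.
Qed.

Lemma ideal_le g : [/\ e \bot <= g &
  forall x y, e x <= g -> e y <= g -> e (x `|` y)%O <= g].
Proof.
by rewrite (canext_bot hC) le0x; split=> // x y qx qy; rewrite omorphU leUx qx.
Qed.

(** * Quotients with finitely many classes *)

Section FiniteQuotient.
Context (Q : E -> E -> Prop) (r : seq E) (p o : E -> C).
Hypothesis lpQ : order_lattice_preorder Q.
Hypothesis leQ : forall x y, x <= y -> Q x y.
Hypothesis rE : forall x, exists2 y, y \in r & equivr Q x y.
Hypothesis pE : forall x, infimums (e @` [set y | Q x y]) (p x).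
Hypothesis oE : forall x, supremums (e @` [set y | Q y x]) (o x).

Lemma quotient_p_le x y : Q x y -> p x <= e y.
Proof. by move=> xy; apply: (pE x).1; exists y. Qed.

Lemma quotient_o_ge x y : Q y x -> e y <= o x.
Proof. by move=> xy; apply: (oE x).1; exists y. Qed.

Lemma quotient_p_mono x y : Q x y -> p x <= p y.
Proof.
move=> xy; apply: (pE y).2 => _ [z /= yz <-]; apply: quotient_p_le.
exact: (lp_trans lpQ) xy yz.
Qed.

Lemma quotient_o_mono x y : Q x y -> o x <= o y.
Proof.
move=> xy; apply: (oE x).2 => _ [z /= zx <-]; apply: quotient_o_ge.
exact: (lp_trans lpQ) zx xy.
Qed.

(** Compactness yields a <= b with x Q a and b Q y. *)
Lemma quotient_p_le_o x y : p x <= o y -> Q x y.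
Proof.
move=> /(canext_filter_ideal (pE x) (oE y)) [].
- exact: (lp_top lpQ).
- by move=> a b; exact: (lp_meet lpQ).
- exact: (lp_bot lpQ).
- by move=> a b; exact: (lp_join lpQ).
move=> a [b [/= xa bY ab]].
exact: (lp_trans lpQ xa (lp_trans lpQ (leQ ab) bY)).
Qed.

Lemma quotient_p_le_open x g : joins_of (range e) g -> p x <= g ->
  exists2 b, Q x b & e b <= g.
Proof.
move=> og /(canext_filter_ideal (pE x) (open_supremum og)) [].
- exact: (lp_top lpQ).
- by move=> a b; exact: (lp_meet lpQ).
- by have [] := ideal_le g.
- by have [] := ideal_le g.
move=> a [b [/= xa bg ab]]; exists b => //.
exact: (lp_trans lpQ xa (leQ ab)).
Qed.

(** It suffices to bound by each open g above u. By compactness g is above some b and b' with x Q b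
    and y Q b', hence above their join. *)
Lemma quotient_pU x y u : p x <= u -> p y <= u -> p (x `|` y)%O <= u.
Proof.
move=> xu yu; have [S So infu] := (canext_dense hC u).2.
apply: infu.2 => g Sg; have ug := infu.1 _ Sg.
have [b xb bg] := quotient_p_le_open (So _ Sg) (le_trans xu ug).
have [b' yb' bg'] := quotient_p_le_open (So _ Sg) (le_trans yu ug).
apply: (@le_trans _ _ (e (b `|` b')%O)); last by rewrite omorphU leUx bg.
apply: quotient_p_le; apply: (lp_join lpQ).
  exact: (lp_trans lpQ xb (lp_joinl lpQ _ _)).
exact: (lp_trans lpQ yb' (lp_joinr lpQ _ _)).
Qed.

Lemma quotient_least (F : set E) : F !=set0 ->
    (forall x y, F x -> F y -> F (x `&` y)%O) ->
  exists2 c, F c & forall a, F a -> Q c a.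
Proof.
move=> F0 FI; apply: (least_modulo (op := Order.meet) (r := r)) => //.
- exact: (lp_trans lpQ).
- exact: (lp_meetl lpQ).
- exact: (lp_meetr lpQ).
Qed.

Lemma quotient_greatest (I : set E) : I !=set0 ->
    (forall x y, I x -> I y -> I (x `|` y)%O) ->
  exists2 c, I c & forall a, I a -> Q a c.
Proof.
move=> I0 II.
apply: (least_modulo (Q := fun x y => Q y x) (op := Order.join) (r := r)) => //.
- by move=> y x z xy yz; exact: (lp_trans lpQ) yz xy.
- exact: (lp_joinl lpQ).
- exact: (lp_joinr lpQ).
- by move=> x; have [y yr [xy yx]] := rE x; exists y.
Qed.

(* [x] represents the image of [u] under the extension to [C] of the quotient
   map of [E] modulo [Q]. *)
Lemma quotient_image u : exists x, p x <= u <= o x.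
Proof.
(* Its class is the largest one whose [p] is below u, by [quotient_pU]. *)
pose x := \join_(y <- r | p y <= u) y.
have px : p x <= u.
  rewrite /x; elim/big_ind: _ => //; last by move=> y z; exact: quotient_pU.
  apply: le_trans (le0x u); rewrite -(canext_bot hC); apply: quotient_p_le.
  exact: (lp_bot lpQ).
(* u is a join of closed q. The filter above q has a least class c, and p c <= q <= u puts a
   representative of c into the join x; so q <= e c <= o x. *)
exists x; rewrite px /=; have [S Sc supu] := (canext_dense hC u).1.
apply: supu.2 => q Sq; have infq := closed_infimum (Sc _ Sq).
have [top_q meet_q] := filter_ge q.
have [|c qc Qc] := quotient_least (F := [set a | q <= e a]) _ meet_q.
  by exists \top.
have pcu : p c <= u.
  apply: le_trans (supu.1 _ Sq); apply: infq.2 => _ [a qa <-].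
  by apply: quotient_p_le; exact: Qc.
apply: le_trans qc _; apply: quotient_o_ge.
have [y yr [cy yc]] := rE c; apply: (lp_trans lpQ cy); apply: leQ.
by apply: joins_sup_seq => //; exact: le_trans (quotient_p_mono yc) pcu.
Qed.

(** If z represents the image of v, then not p x <= v forces not x Q z, while v <= o z; and p x <= v
    <= o y would give x Q y. *)
Lemma quotient_splits_p x : splits (p x).
Proof.
exists [seq o y | y <- r & `[< ~ Q x y >]]; apply/seteqP; split=> v /=.
  move=> npv; have [z /andP[pz zo]] := quotient_image v.
  have [y yr [zy yz]] := rE z.
  exists (o y); last exact: le_trans zo (quotient_o_mono zy).
  apply: map_f; rewrite mem_filter yr andbT; apply/asboolP => xy.
  apply: npv; apply: le_trans pz; apply: quotient_p_mono.
  exact: (lp_trans lpQ xy yz).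
move=> [_ /mapP[y + ->] vo pv]; rewrite mem_filter => /andP[/asboolP nxy _].
by apply: nxy; apply: quotient_p_le_o; exact: le_trans pv vo.
Qed.

Lemma quotient_splits_o x : @splits _ (C^d)%type (o x).
Proof.
exists [seq p y | y <- r & `[< ~ Q y x >]]; apply/seteqP; split=> v /=.
  move=> nvo; have [z /andP[pz zo]] := quotient_image v.
  have [y yr [zy yz]] := rE z.
  exists (p y); last exact: (le_trans (quotient_p_mono yz) pz : p y <= v).
  apply: map_f; rewrite mem_filter yr andbT; apply/asboolP => yx.
  apply: nvo; rewrite /= leEdual; apply: le_trans zo (quotient_o_mono _).
  exact: (lp_trans lpQ zy yx).
move=> [_ /mapP[y + ->] pv vo]; rewrite mem_filter => /andP[/asboolP nyx _].
by apply: nyx; apply: quotient_p_le_o; exact: (@le_trans _ C v (p y) (o x)).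
Qed.

End FiniteQuotient.

(** * Density of splitting elements in the canonical extension *)

Context (dA : Order.disp_t) (A : finTBLatticeType dA).
Hypothesis hE : in_variety_generated_by A E.

(** Density gives a closed q <= u and an open g >= w with not q <= g. Jonsson's lemma separates the
    filter above q from the ideal below g; the witnesses are p of the least class of the filter and
    o of the greatest class of the ideal. *)
Lemma canext_separation u w : ~ u <= w -> exists a b : C,
  [/\ splits a, @splits _ (C^d)%type b, a <= u, w <= b & ~ a <= b].
Proof.
move=> nuw; have [S Sc supu] := (canext_dense hC u).1.
have [q Sq nqw] : exists2 q, S q & ~ q <= w.
  apply: contrapT => nS; apply: nuw; apply: supu.2 => q Sq.
  by apply: contrapT => nqw; apply: nS; exists q.
have [T To infw] := (canext_dense hC w).2.
have [g Tg nqg] : exists2 g, T g & ~ q <= g.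
  apply: contrapT => nT; apply: nqw; apply: infw.2 => g Tg.
  by apply: contrapT => nqg; apply: nT; exists g.
have [top_q meet_q] := filter_ge q; have [bot_g join_g] := ideal_le g.
have [|||Q [lpQ leQ [r rE] nQ]] :=
  variety_separation hE (F := [set a | q <= e a]) (I := [set b | e b <= g])
    meet_q join_g.
- by exists \top.
- by exists \bot.
- move=> x y qx yg xy; apply: nqg; apply: le_trans qx (le_trans _ yg).
  by rewrite canext_le.
have {}rE x : exists2 y, y \in r & equivr Q x y.
  by have /hasP[y yr /asboolP] := rE x; exists y.
have [p pE] := choice (fun x => (canext_complete hC (e @` [set y | Q x y])).2).
have [o oE] := choice (fun x => (canext_complete hC (e @` [set y | Q y x])).1).
have [|c qc Qc] := quotient_least lpQ rE (F := [set a | q <= e a]) _ meet_q.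
  by exists \top.
have [|d gd Qd] := quotient_greatest lpQ rE (I := [set b | e b <= g]) _ join_g.
  by exists \bot.
exists (p c), (o d); split.
- exact: (quotient_splits_p lpQ leQ rE pE oE).
- exact: (quotient_splits_o lpQ leQ rE pE oE).
- apply: le_trans (supu.1 _ Sq); apply: (closed_infimum (Sc _ Sq)).2.
  by move=> _ [a qa <-]; apply: (quotient_p_le pE); exact: Qc.
- apply: le_trans (infw.1 _ Tg) _; apply: (open_supremum (To _ Tg)).2.
  by move=> _ [b gb <-]; apply: (quotient_o_ge oE); exact: Qd.
- by move/(quotient_p_le_o lpQ leQ pE oE); exact: nQ.
Qed.

Lemma canext_splits_dense : @splits_dense _ C.
Proof.
move=> u w /canext_separation[a [b [sa _ au wb nab]]]; exists a; split=> //.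
by move=> aw; apply: nab; exact: le_trans aw wb.
Qed.

Lemma canext_splits_dense_dual : @splits_dense _ (C^d)%type.
Proof.
move=> u w /(@canext_separation w u)[a [b [_ sb au wb nab]]].
exists b; split=> // bw; apply: nab; exact: le_trans au bw.
Qed.

End CanonicalExtension.

Theorem theorem5 (dA dE dC : Order.disp_t)
    (A : finTBLatticeType dA) (E : tbLatticeType dE) (C : tbLatticeType dC)
    (e : {lmorphism E -> C})
    (hE : in_variety_generated_by A E)
    (hC : is_canonical_extension e) :
  doubly_algebraic C /\
  (@open (scott_space C) = @open (upper_space C) :> set (set C) /\
   spectral_space (scott_space C)) /\
  (@open (scott_space (C^d)%type) = @open (lower_space C) :> set (set C) /\
   spectral_space (scott_space (C^d)%type)) /\
  ((forall U : set C,
      @compact_opens (scott_space C) U <->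
      @compact_opens (scott_space (C^d)%type) (~` U)) /\
   (forall U : set C, @compact_opens (scott_space C) U -> upper_tooth U) /\
   (forall V : set C,
      @compact_opens (scott_space (C^d)%type) V -> lower_tooth V)) /\
  priestley_space (biscott_space C).
Proof.
have cC := canext_complete hC; have cC' := complete_dual cC.
have dC1 := canext_splits_dense hC hE.
have dC2 := canext_splits_dense_dual hC hE.
split; first by split; exact: splits_algebraic.
split; first by split; [exact: scott_open_upper|exact: scott_spectral].
split.
  by split; [exact: (@scott_open_upper _ (C^d)%type)|exact: scott_spectral].
split; last exact: biscott_priestley.
split; first exact: compact_open_setC.
split; first by move=> U /(compact_openE dC1)[].
by move=> V /(compact_openE dC2)[].
Qed.
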